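(* Let $p\in[1,+\infty]$ and $\Lambda\subset\mathbb{N}$. Let $\theta_1,\theta_2\in[0,1)$ be such that $\theta_1-\theta_2$ is irrational and $a$-approximable for some $a>0$. If the system $\{\cos^\lambda 2\pi(t-\theta_1),\ \cos^\lambda 2\pi(t-\theta_2):\lambda\in\Lambda\}$ is total in $X_p(0,1)$, then $\Lambda$ is a $[-1,1]$-Müntz-Szász sequence.
   Context: $\mathbb{N}=\{0,1,2,\ldots\}$. Functions on $[0,1]$ are identified with $1$-periodic functions on $\mathbb{R}$. $X_p(0,1)=L^p(0,1)$ if $1\le p<+\infty$, and $X_\infty(0,1)$ is the space of continuous $1$-periodic functions with the sup norm. A family is total in a normed space if its linear span is dense. A set $\Lambda\subset\mathbb{N}$ is a $[-1,1]$-Müntz-Szász sequence if $0\in\Lambda$, $\sum_{\lambda\in\Lambda,\ \lambda\text{ even},\ \lambda\neq0}\frac1\lambda=+\infty$ and $\sum_{\lambda\in\Lambda,\ \lambda\text{ odd}}\frac1\lambda=+\infty$. For $a>0$, a real number $\theta$ is called $a$-approximable (by rational numbers) if there is a constant $C_\theta>0$ such that the set $\{(m,n)\in\mathbb{Z}^2: n\ge1,\ |m-n\theta|<C_\theta n^{-a}\}$ is finite.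
   Formalization: The conclusion is proved for Λ ∪ {0}: both divergence conditions on Λ are kept, but 0 ∈ Λ is not claimed, since it fails as stated (for Λ = ℕ∖{0}, θ1 = √2−1, θ2 = 0, p finite, the system is total because 1−(1−cos²)^n → 1 in L^p). *)

(* Defs.v *)
From HB Require Import structures.
From mathcomp Require Import all_boot all_order all_algebra.
From mathcomp Require Import all_classical all_reals all_analysis.
From mathcomp Require Import complex.

Set Implicit Arguments.
Unset Strict Implicit.
Unset Printing Implicit Defensive.

Import Order.TTheory GRing.Theory Num.Theory.
Import numFieldNormedType.Exports.

Local Open Scope classical_set_scope.
Local Open Scope ring_scope.

Section PeriodicSpaces.
Context {R : realType}.

Definition lebesgue01 : {measure set measurableTypeR R -> \bar R} :=
  mrestr (@lebesgue_measure R)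
    (measurable_itv `]0, 1[ : measurable (`]0, 1[ : set (measurableTypeR R))).

Definition modulus (f : R -> R[i]) : R -> R := fun t => Normc.normc (f t).

Definition one_periodic (f : R -> R[i]) := forall t, f (t + 1) = f t.

(* Functions on [0,1] are represented by 1-periodic functions on R, not taken
   up to a.e. equality: the quotient plays no role for density.  R[i] itself
   carries no topology in the library, hence R[i]^o. *)
Definition X (p : \bar R) : set (R -> R[i]) :=
  [set f | one_periodic f /\
    if p == +oo%E then continuous (f : R -> R[i]^o)
    else [/\ measurable_fun setT (fun t => complex.Re (f t)),
             measurable_fun setT (fun t => complex.Im (f t)) &
             modulus f \in Lfun lebesgue01 p]].

Definition Xnorm (p : \bar R) (f : R -> R[i]) : \bar R :=
  if p == +oo%E then ereal_sup [set (modulus f t)%:E | t in [set: R]]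
  else Lnorm lebesgue01 p (EFin \o modulus f).

Definition lin_span (S : set (R -> R[i])) : set (R -> R[i]) :=
  [set g | exists (n : nat) (c : 'I_n -> R[i]) (phi : 'I_n -> R -> R[i]),
    (forall k, S (phi k)) /\ g = (fun t => \sum_(k < n) c k * phi k t)].

Definition total_in (p : \bar R) (S : set (R -> R[i])) : Prop :=
  S `<=` X p /\
  forall f, X p f -> forall e : R, 0 < e ->
    exists2 g, lin_span S g & (Xnorm p (fun t => (f t - g t)%R) < e%:E)%E.

Definition cos_pow (theta : R) (l : nat) : R -> R[i] :=
  fun t => ((cos (2 * pi * (t - theta)) ^+ l)%:C)%C.

Definition approximable (a theta : R) : Prop :=
  exists2 C : R, 0 < C &
    finite_set [set mn : int * int | (1 <= mn.2) /\
      `|mn.1%:~R - mn.2%:~R * theta| < C * (mn.2%:~R `^ (- a))].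

End PeriodicSpaces.

(* The clause [Lambda 0] cannot be deduced from totality of the cosine powers:
   for Lambda = {l | l <> 0} and p finite, 1 - (1 - cos^2 x)^n tends to 1 in
   L^p, so removing the exponent 0 does not change the closed span. *)
Definition Muntz_Szasz (R : realType) (Lambda : set nat) : Prop :=
  [/\ Lambda 0%N,
      \esum_(l in [set l | [/\ Lambda l, ~~ odd l & l != 0%N]])
        (l%:R^-1 : R)%:E = +oo%E &
      \esum_(l in [set l | Lambda l /\ odd l]) (l%:R^-1 : R)%:E = +oo%E].

(* Main.v *)
From HB Require Import structures.
Require Import Defs.
From mathcomp Require Import all_boot all_order all_algebra.
From mathcomp Require Import all_classical all_reals all_analysis.
From mathcomp Require Import measurable_realfun complex polyrcf ring lra zify.

Set Implicit Arguments.
Unset Strict Implicit.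
Unset Printing Implicit Defensive.

Import Order.TTheory GRing.Theory Num.Theory.
Import numFieldNormedType.Exports.

Local Open Scope classical_set_scope.
Local Open Scope ring_scope.

(** If the reciprocals of the exponents of one parity, even or odd, have a
    finite sum, then totality fails because of a single function: the power
    x^m of the cosine around theta1, where m > 0 has that parity and is not
    in Lambda.  Suppose that it is approximated within e in X_p by
    P(cos 2 pi (t - theta1)) + Q(cos 2 pi (t - theta2)), with P and Q combining
    exponents of Lambda, and expand P - x^m = sum_n c_n T_n in Chebyshev
    polynomials.  Integrating the error against sin (2 pi n (t - theta2)) kills
    the part centred at theta2, which is even about that point, and leaves
    c_n sin (2 pi n (theta1 - theta2)) / 2 ([has_mean_cheb_sum]).  Since
    theta1 - theta2 is irrational and a-approximable, the sine is at least a
    constant times n^-2k ([sin_small_divisors]), so |c_n| <= C e n^2k for all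
    n > 0.  The coefficient c_0 is not controlled, as it can be exchanged
    between P and Q.

    It remains to exhibit linear functionals L on polynomials which vanish on
    the constants, on the exponents used by P and on the other parity, are
    bounded away from 0 at x^m, and satisfy |L T_n| <= C n^-(2k+2), all uniformly in P:
    then |L x^m| = |L (P - x^m)| <= C e sum_n n^-2, which is absurd for small e
    ([monomial_gap]).

    Such functionals are built by operators that are diagonal on monomials.
    Let [moment] be the integral over [0, 1], [avg] the Hardy averaging operator
    x^k |-> x^k / (k + 1), and B_l the operator
    x^k |-> (k - l) / (k + l + 1) x^k, which kills x^l.  Put
      L q = moment (B_(N+l1) ... B_(N+lr) avg^N (x^N q')),
    where q' is the part of q of the chosen parity and the li are 0 and the
    exponents of P of that parity.  Each B_l is a contraction
    of L^2(0, 1) ([blaschke_contraction]), as the adjoint of multiplication by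
    a Blaschke factor on the Mellin side, so the number of factors does not
    affect the upper bounds.  The factor at k = m is at least exp (- A / l), so
    a bound on the sum of the 1/l bounds |L x^m| from below
    ([annihilator_Xn_lower]).  Finally T_n is an eigenvector, with eigenvalue
    - n^2, of D = (1 - x^2) d^2/dx^2 - x d/dx, and integrating by parts shows
    that avg^N absorbs N derivatives with bounds in the sup norm
    ([smoothed_iter_cheb_op]).  Hence n^2j |L T_n| = |L (D^j T_n)| is bounded
    for N = 2j. *)

(** * Diagonal operators on polynomials *)

Section Diagonal.
Variable K : comNzRingType.
Implicit Types (w : nat -> K) (p q : {poly K}).

Definition diag w p : {poly K} := \poly_(i < size p) (w i * p`_i).

Lemma coef_diag w p i : (diag w p)`_i = w i * p`_i.
Proof.
rewrite coef_poly; case: ltnP => // /(nth_default 0) ->; by rewrite mulr0.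
Qed.

Lemma diag_is_linear w : linear (diag w).
Proof.
move=> a p q; apply/polyP => i.
by rewrite !(coefD, coefZ, coef_diag) mulrDr mulrCA.
Qed.

HB.instance Definition _ w :=
  GRing.isLinear.Build K {poly K} {poly K} _ (diag w) (diag_is_linear w).

Lemma diagXn w k : diag w 'X^k = w k *: 'X^k.
Proof.
apply/polyP => i; rewrite coef_diag coefZ coefXn.
by case: eqP => [->|]; rewrite ?mulr0.
Qed.

End Diagonal.

(** * Moments on the unit interval and contractions *)

Section Averaging.
Variable R : rcfType.
Implicit Types p q f : {poly R}.

(** The Hardy operator p |-> (1 / x) * (integral of p from 0 to x), with its
    removable singularity at 0 filled in. *)
Definition avg : {poly R} -> {poly R} := diag (fun k => k.+1%:R^-1).

HB.instance Definition _ := GRing.Linear.on avg.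

(** The integral of p over [0, 1]: averaging up to the endpoint 1. *)
Definition moment p : R := (avg p).[1].

Lemma avg_deriv_mulX p : avg ('X * p)^`() = p.
Proof.
apply/polyP => i; rewrite coef_diag coef_deriv coefXM /= -[_`__ *+ _]mulr_natl.
by rewrite mulrA mulVf ?mul1r // pnatr_eq0.
Qed.

Lemma deriv_mulX_avg p : ('X * avg p)^`() = p.
Proof.
apply/polyP => i; rewrite coef_deriv coefXM /= coef_diag -[_ * _ *+ _]mulr_natl.
by rewrite mulrA divff ?mul1r // pnatr_eq0.
Qed.

Lemma moment_is_linear : linear_for *%R moment.
Proof. by move=> a p q; rewrite /moment linearP hornerD hornerZ. Qed.

HB.instance Definition _ :=
  GRing.isLinear.Build R {poly R} R _ moment moment_is_linear.

Lemma momentZ a p : moment (a *: p) = a * moment p.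
Proof. exact: linearZ. Qed.

Lemma moment_deriv p : moment p^`() = p.[1] - p.[0].
Proof.
suff e : p = p.[0]%:P + 'X * avg p^`().
  rewrite [in p.[1]]e hornerD hornerC hornerM hornerX mul1r.
  by rewrite addrAC subrr add0r.
apply/polyP => -[|i]; rewrite coefD coefC coefXM /= ?addr0 ?horner_coef0 //.
rewrite coef_diag coef_deriv add0r -[_`__ *+ _]mulr_natl mulrA mulVf ?mul1r //.
Qed.

(** The mean value theorem for x * avg p, whose derivative is p.  This single
    fact yields every sup norm estimate and the positivity of [moment]. *)
Lemma avg_mean p x : 0 <= x <= 1 ->
  exists2 c, 0 <= c <= 1 & (avg p).[x] = p.[c].
Proof.
move=> /andP[x0 x1]; have [->|xN0] := eqVneq x 0.
  exists 0; first by rewrite lexx ler01.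
  by rewrite !horner_coef0 coef_diag invr1 mul1r.
have xgt0 : 0 < x by rewrite lt_def xN0.
have [c /itvP cx] := poly_mvt ('X * avg p) xgt0.
rewrite deriv_mulX_avg !hornerM !hornerX mul0r !subr0 => e.
exists c; first by rewrite cx (le_trans _ x1) ?cx.
by apply: (mulfI xN0); rewrite e mulrC.
Qed.

Lemma moment_mean p : exists2 c, 0 <= c <= 1 & moment p = p.[c].
Proof. by apply: avg_mean; rewrite ler01 lexx. Qed.

Definition l2sq p := moment (p * p).

Lemma l2sq_le p (M : R) : 0 <= M ->
  (forall x, 0 <= x <= 1 -> `|p.[x]| <= M) -> l2sq p <= M ^+ 2.
Proof.
move=> M0 h; have [c c01] := moment_mean (p * p); rewrite /l2sq => ->.
by rewrite hornerM -expr2 -real_normK ?num_real // lerXn2r ?nnegrE // h.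
Qed.

(** Cauchy-Schwarz against the constant 1: the square of p minus its mean has
    a nonnegative integral. *)
Lemma moment_le_l2 p : moment p ^+ 2 <= l2sq p.
Proof.
set m := moment p.
have [c _ e] := moment_mean ((p - m%:P) * (p - m%:P)).
have : 0 <= moment ((p - m%:P) * (p - m%:P)) by rewrite e hornerM -expr2 sqr_ge0.
have -> : (p - m%:P) * (p - m%:P) = p * p - (m *+ 2) *: p + m ^+ 2 *: 1.
  by rewrite -!mul_polyC -mulr_natl rmorphM rmorphXn rmorph_nat; ring.
rewrite raddfD raddfB /= !momentZ -/m.
have -> : moment 1 = 1.
  by rewrite -(expr0 'X) /moment /avg diagXn !hornerE invr1.
rewrite -/(l2sq p); lra.
Qed.

(** In the variable k this is the multiplication by the Blaschke factor of the
    half-plane Re k > -1/2 which vanishes at l. *)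
Definition blaschke l : {poly R} -> {poly R} :=
  diag (fun k => (k%:R - l%:R) / (k + l).+1%:R).

HB.instance Definition _ l := GRing.Linear.on (blaschke l).

(** Let u solve x u' + (l + 1) u = p.  Then [blaschke l p] is x u' - l u, and the
    squares of the two functions differ by (2 l + 1) (x u^2)', whose integral
    over [0, 1] is (2 l + 1) u(1)^2 >= 0. *)
Lemma blaschke_contraction l p : l2sq (blaschke l p) <= l2sq p.
Proof.
pose u := diag (fun k => (k + l).+1%:R^-1 : R) p.
have n0 i : (i + l).+1%:R != 0 :> R by rewrite pnatr_eq0.
have ep : p = 'X * u^`() + l.+1%:R *: u.
  apply/polyP => i; rewrite coefD coefXM coefZ coef_deriv !coef_diag.
  case: i => [|i] /=; first by rewrite add0r add0n mulrA divff // mul1r.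
  by rewrite -[_ * _ *+ _]mulr_natl -mulrDl -natrD addnS mulrA divff // mul1r.
have eW : blaschke l p = 'X * u^`() - l%:R *: u.
  apply/polyP => i; rewrite coefB coefXM coefZ coef_deriv !coef_diag.
  case: i => [|i] /=; first by rewrite mulr0n !sub0r !mulNr mulrA.
  by rewrite -[_ * _ *+ _]mulr_natl -mulrBl mulrA.
rewrite -subr_ge0 /l2sq -linearB /= eW {1 2}ep.
have -> : ('X * u^`() + l.+1%:R *: u) * ('X * u^`() + l.+1%:R *: u) -
  ('X * u^`() - l%:R *: u) * ('X * u^`() - l%:R *: u) =
  (l + l).+1%:R *: ('X * (u * u))^`().
  rewrite !derivM derivX -!mul_polyC !rmorph_nat -addn1 -[(l + l).+1]addn1 !natrD.
  ring.
rewrite momentZ moment_deriv !hornerM !hornerX mul1r mul0r subr0 -expr2.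
by rewrite mulr_ge0 ?ler0n ?sqr_ge0.
Qed.

(** * Averages of derivatives are bounded in sup norm *)

Definition supbounded (op : {poly R} -> {poly R}) :=
  exists C : R, forall q (M : R), 0 <= M ->
    (forall x : R, 0 <= x <= 1 -> `|q.[x]| <= M) ->
    forall x : R, 0 <= x <= 1 -> `|(op q).[x]| <= C * M.

Lemma supbounded_avg op : supbounded op -> supbounded (avg \o op).
Proof.
move=> [C hC]; exists C => q M M0 hq x /(avg_mean (op q)) [c c01 /= ->].
exact: hC hq _ c01.
Qed.

Lemma supboundedB op1 op2 : supbounded op1 -> supbounded op2 ->
  supbounded (fun q => op1 q - op2 q).
Proof.
move=> [C1 h1] [C2 h2]; exists (C1 + C2) => q M M0 hq x hx.
by rewrite hornerD hornerN mulrDl (le_trans (ler_normB _ _)) // lerD // (h1, h2).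
Qed.

Lemma supboundedM a : supbounded (fun q => a * q).
Proof.
have [C hC] := poly_itv_bound a 0 1.
exists C => q M M0 hq x hx.
by rewrite hornerM normrM ler_pM // ?hC ?hq.
Qed.
(** N averages compensate the loss of regularity of [op].  The multiplier
    [a] is arbitrary, and the factor x^N is present, so that the property
    survives the product rule in [smoothed_deriv]. *)
Definition smoothed N (op : {poly R} -> {poly R}) :=
  forall a : {poly R}, supbounded (fun q => iter N avg ('X^N * a * op q)).

Lemma smoothed_id : smoothed 0 id.
Proof. by move=> a; rewrite /= expr0 mul1r; exact: supboundedM. Qed.

Lemma iter_avgP N a p q :
  iter N avg (a *: p + q) = a *: iter N avg p + iter N avg q.
Proof. by elim: N => //= N ->; rewrite linearP. Qed.

Lemma iter_avgZ N a p : iter N avg (a *: p) = a *: iter N avg p.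
Proof. by elim: N => //= N ->; rewrite linearZ. Qed.

Lemma iter_avgB N p q : iter N avg (p - q) = iter N avg p - iter N avg q.
Proof. by elim: N => //= N ->; rewrite linearB. Qed.

Lemma smoothedM N b op : smoothed N op -> smoothed N (fun q => b * op q).
Proof.
move=> h a; have [C hC] := h (a * b); exists C => q M M0 hq x hx.
by rewrite mulrA -[_ * a * b]mulrA hC.
Qed.

Lemma smoothedB N op1 op2 : smoothed N op1 -> smoothed N op2 ->
  smoothed N (fun q => op1 q - op2 q).
Proof.
move=> h1 h2 a; have [C hC] := supboundedB (h1 a) (h2 a).
by exists C => q M M0 hq x hx; rewrite mulrBr iter_avgB hC.
Qed.

Lemma smoothedS N op : smoothed N op -> smoothed N.+1 op.
Proof.
move=> h a; have [C hC] := supbounded_avg (h ('X * a)).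
exists C => q M M0 hq x hx.
by rewrite /= exprSr -[_ * 'X * a]mulrA hC.
Qed.

(** Integration by parts: avg (x f p') = f p - avg ((x f)' p) with
    f = x^N a and p = op q, where (x f)' is again x^N times a polynomial. *)
Lemma smoothed_deriv N op :
  smoothed N op -> smoothed N.+1 (fun q => (op q)^`()).
Proof.
move=> h a.
pose b : {poly R} := N.+1%:R *: a + 'X * a^`().
have [C hC] := supboundedB (h a) (supbounded_avg (h b)).
exists C => q M M0 hq x hx.
have -> : 'X^(N.+1) * a * (op q)^`() =
    ('X * ('X^N * a * op q))^`() - 'X^N * b * op q.
  rewrite -['X^N * a * op q]mulrA ['X * _]mulrA -exprS 2!derivM derivXn /b.
  rewrite -mul_polyC rmorph_nat /=.
  by rewrite -[_ *+ N.+1]mulr_natl exprS; ring.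
by rewrite iter_avgB [in iter N.+1 avg (deriv _)]iterSr avg_deriv_mulX hC.
Qed.

End Averaging.

(** * Chebyshev polynomials *)

Section Chebyshev.
Variable R : realType.
Implicit Types p q : {poly R}.

(** The state of the iteration is the pair of consecutive polynomials
    (T_n, T_(n+1)). *)
Definition cheb n : {poly R} :=
  (iter n (fun s => (s.2, 'X * s.2 *+ 2 - s.1)) (1, 'X)).1.

Lemma cheb0 : cheb 0 = 1. Proof. by []. Qed.
Lemma cheb1 : cheb 1 = 'X. Proof. by []. Qed.
Lemma chebSS n : cheb n.+2 = 'X * cheb n.+1 *+ 2 - cheb n. Proof. by []. Qed.

Lemma cheb_ind (P : nat -> Prop) :
  P 0%N -> P 1%N -> (forall n, P n -> P n.+1 -> P n.+2) -> forall n, P n.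
Proof.
move=> P0 P1 PS n; suff [] : P n /\ P n.+1 by [].
by elim: n => [|n [Pn PSn]]; split => //; exact: PS.
Qed.

Lemma cheb_cos n (s : R) : (cheb n).[cos s] = cos (n%:R * s).
Proof.
elim/cheb_ind: n => [||n IH0 IH1]; first by rewrite cheb0 hornerC mul0r cos0.
  by rewrite cheb1 hornerX mul1r.
rewrite chebSS hornerD hornerN hornerMn hornerM hornerX IH0 IH1.
have -> : n.+2%:R * s = n.+1%:R * s + s by rewrite -[n.+2%:R]natr1; ring.
have -> : n%:R * s = n.+1%:R * s - s by rewrite -[n.+1%:R]natr1; ring.
by rewrite cosB cosD; ring.
Qed.

Lemma cheb_le1 n (x : R) : 0 <= x <= 1 -> `|(cheb n).[x]| <= 1.
Proof.
move=> /andP[x0 x1]; rewrite -(@acosK R x) ?in_itv /= ?x1 ?andbT; last first.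
  by rewrite (le_trans _ x0) // lerN10.
by rewrite cheb_cos ler_norml cos_geN1 cos_le1.
Qed.

Lemma coef_cheb_parity n i : odd i != odd n -> (cheb n)`_i = 0.
Proof.
elim/cheb_ind: n i => [||n IH0 IH1] i; first by rewrite cheb0 coefC; case: i.
  by rewrite cheb1 coefX; case: i => [|[|i]].
rewrite /= negbK chebSS coefB coefMn coefXM => h.
rewrite IH0 // subr0; case: i h => [|i] /= h; first by rewrite mul0rn.
by rewrite IH1 ?mul0rn // -(inj_eq negb_inj) negbK.
Qed.

Definition parity_part (b : bool) : {poly R} -> {poly R} :=
  diag (fun k => (odd k == b)%:R).

HB.instance Definition _ b := GRing.Linear.on (parity_part b).

Lemma parity_part_cheb b n :
  parity_part b (cheb n) = (odd n == b)%:R *: cheb n.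
Proof.
apply/polyP => i; rewrite coef_diag coefZ.
have [->//|h] := eqVneq (odd i) (odd n).
by rewrite coef_cheb_parity // !mulr0.
Qed.

(** In the variable x = cos s this is the second derivative in s. *)
Definition cheb_op q := (1 - 'X^2) * q^`()^`() - 'X * q^`().

(** The two first-order relations are proved together, since each one at the
    next index uses both. *)
Lemma cheb_deriv n :
  (1 - 'X^2) * (cheb n)^`() = n%:R *: ('X * cheb n - cheb n.+1) /\
  (1 - 'X^2) * (cheb n.+1)^`() = n.+1%:R *: (cheb n - 'X * cheb n.+1).
Proof.
elim: n => [|n [IH0 IH1]].
  by rewrite cheb0 cheb1 derivC derivX scale0r mulr0 scale1r; split=> //; ring.
split; rewrite chebSS.
  by rewrite IH1; congr (_ *: _); ring.
rewrite derivB derivMn derivM derivX mul1r mulrBr mulrnAr mulrDr.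
rewrite mulrCA IH0 IH1 -!mul_polyC !rmorph_nat -[n.+2%:R]natr1 -[n.+1%:R]natr1.
ring.
Qed.

(** Differentiate the first relation of [cheb_deriv], multiply by 1 - x^2 to
    eliminate all first derivatives, and cancel 1 - x^2. *)
Lemma cheb_eigen n : cheb_op (cheb n) = - (n%:R ^+ 2) *: cheb n.
Proof.
have [e0 e1] := cheb_deriv n.
set T := cheb n in e0 e1 *; set U := cheb n.+1 in e0 e1.
have w0 : 1 - 'X^2 != 0 :> {poly R}.
  apply/eqP => /(congr1 (fun p : {poly R} => p.[0])).
  by rewrite !hornerE => /eqP; rewrite expr0n subr0 oner_eq0.
have e2 := congr1 (@deriv R) e0.
rewrite derivM derivB derivC derivXn derivZ derivB derivM derivX sub0r in e2.
move: e0 e1 e2; rewrite -!mul_polyC !rmorphN !rmorphXn !rmorph_nat /= expr1.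
rewrite -[n.+1%:R]natr1 /cheb_op.
set c : {poly R} := n%:R; set T' := T^`(); set T'' := T'^`(); set U' := U^`().
move=> e0 e1 e2.
apply: (mulfI w0).
have -> : (1 - 'X^2) * T'' = 'X *+ 2 * T' + c * (1 * T + 'X * T' - U').
  by rewrite -e2; ring.
have -> : (1 - 'X^2) * ('X *+ 2 * T' + c * (1 * T + 'X * T' - U') - 'X * T') =
  (1 + c) * 'X * ((1 - 'X^2) * T') + c * ((1 - 'X^2) * T) - c * ((1 - 'X^2) * U').
  by ring.
by rewrite e0 e1; ring.
Qed.

Lemma coef_cheb_lead n :
  0 < (cheb n)`_n /\ forall i, (n < i)%N -> (cheb n)`_i = 0.
Proof.
elim/cheb_ind: n => [||n [_ IH0] [IHl IH1]].
- by rewrite cheb0 coefC ltr01; split => // -[|i] //; rewrite coefC.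
- by rewrite cheb1 coefX ltr01; split => // -[|[|i]] //; rewrite coefX.
- rewrite chebSS; split => [|[|i]] //.
    by rewrite coefB coefMn coefXM /= IH0 ?subr0 ?pmulrn_rgt0.
  rewrite ltnS => ni; rewrite coefB coefMn coefXM /= IH1 // IH0 ?subr0 ?mul0rn //.
  by rewrite ltnS ltnW // ltnW.
Qed.

Lemma cheb_expand d p : (size p <= d)%N ->
  exists c : nat -> R, p = \sum_(n < d) c n *: cheb n.
Proof.
elim: d p => [|d IH] p.
  by rewrite leqn0 size_poly_eq0 => /eqP ->; exists (fun=> 0); rewrite big_ord0.
move=> sp; have [lead high] := coef_cheb_lead d.
pose r := p`_d / (cheb d)`_d.
have [|c ec] := IH (p - r *: cheb d).
  apply/leq_sizeP => i; rewrite leq_eqVlt => /predU1P[<-|di].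
    by rewrite coefB coefZ divfK ?subrr // gt_eqF.
  by rewrite coefB coefZ high // mulr0 subr0 nth_default // (leq_trans sp).
exists (fun n => if n == d then r else c n).
rewrite big_ord_recr /= eqxx -[LHS](subrK (r *: cheb d)) ec; congr (_ + _).
by apply: eq_bigr => i _; rewrite ltn_eqF.
Qed.

End Chebyshev.

(** * Functionals vanishing on prescribed powers *)

Section Annihilator.
Variable R : realType.
Implicit Types p q : {poly R}.

(** The factor x^N turns x^k into x^(N+k), which is why the exponents killed by
    the Blaschke operators are shifted by N too. *)
Definition annihilator b N (F : seq nat) q : R :=
  moment (foldr (fun l => blaschke (N + l))
                (iter N (@avg R) ('X^N * parity_part b q)) F).

Lemma annihilator_is_linear b N F : linear_for *%R (annihilator b N F).
Proof.
move=> a p q; rewrite /annihilator !linearP /= mulrDr -scalerAr.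
rewrite iter_avgP.
set u := iter _ _ _; set v := iter _ _ _.
suff -> : foldr (fun l => blaschke (N + l)) (a *: u + v) F =
    a *: foldr (fun l => blaschke (N + l)) u F +
    foldr (fun l => blaschke (N + l)) v F.
  by rewrite linearP.
by elim: F => //= l F ->; rewrite linearP.
Qed.

HB.instance Definition _ b N F :=
  GRing.isLinear.Build R {poly R} R _ _ (annihilator_is_linear b N F).

Lemma annihilatorXn b N F k : annihilator b N F 'X^k =
  (odd k == b)%:R * (N + k).+1%:R^-1 ^+ N.+1 *
    \prod_(l <- F) ((k%:R - l%:R) / (N + k + (N + l)).+1%:R).
Proof.
rewrite /annihilator /parity_part diagXn -scalerAr -exprD.
set c : R := (odd k == b)%:R.
have -> m : iter m (@avg R) (c *: 'X^(N + k)) =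
    (c * (N + k).+1%:R^-1 ^+ m) *: 'X^(N + k).
  elim: m => [|m IH] /=; first by rewrite expr0 mulr1.
  by rewrite IH linearZ /= /avg diagXn scalerA exprSr mulrA.
have -> d : foldr (fun l => blaschke (N + l)) (d *: 'X^(N + k)) F =
   (d * \prod_(l <- F) ((k%:R - l%:R) / (N + k + (N + l)).+1%:R)) *: 'X^(N + k).
  elim: F => [|l F IH] /=; first by rewrite big_nil mulr1.
  rewrite IH big_cons linearZ /= /blaschke diagXn scalerA; congr (_ *: _).
  by rewrite !natrD; ring.
rewrite linearZ /= /moment /avg diagXn hornerZ hornerXn expr1n mulr1 exprSr; ring.
Qed.

(** The bound does not see the list F, because every Blaschke operator is a
    contraction for [l2sq]. *)
Lemma annihilator_sqr_le b N F q :
  annihilator b N F q ^+ 2 <= l2sq (iter N (@avg R) ('X^N * parity_part b q)).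
Proof.
apply: le_trans (moment_le_l2 _) _.
by elim: F => //= l F; apply: le_trans; exact: blaschke_contraction.
Qed.

Lemma smoothed_cheb_op N (op : {poly R} -> {poly R}) :
  smoothed N op -> smoothed N.+2 (fun q => cheb_op (op q)).
Proof.
move=> h; apply: smoothedB; apply: smoothedM.
  exact/smoothed_deriv/smoothed_deriv.
exact/smoothedS/smoothed_deriv.
Qed.

Lemma smoothed_iter_cheb_op j : smoothed (2 * j) (iter j (@cheb_op R)).
Proof.
elim: j => [|j IH]; first exact: smoothed_id.
by rewrite mulnS; exact: smoothed_cheb_op.
Qed.

(** Replace n^2j T_n by (-1)^j D^j T_n: the functional is bounded on D^j q by the
    sup norm of q, which is at most 1 when q is T_n. *)
Lemma annihilator_cheb_decay b j : exists2 C : R, 0 < C & forall F n,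
  n%:R ^+ (2 * j) * `|annihilator b (2 * j) F (cheb R n)| <= C.
Proof.
have [C hC] := smoothed_iter_cheb_op j 1.
exists (`|C| + 1) => [|F n]; first by rewrite ltr_pwDr.
set N := (2 * j)%N.
have eD : iter j (@cheb_op R) (cheb R n) = (-1) ^+ j * n%:R ^+ N *: cheb R n.
  rewrite {}/N {hC}; elim: j => [|j IH]; first by rewrite !expr0 mulr1 scale1r.
  rewrite iterS IH.
  have -> (c : R) p : cheb_op (c *: p) = c *: cheb_op p.
    rewrite /cheb_op !derivZ -!mul_polyC; ring.
  by rewrite cheb_eigen scalerA mulnS exprD !exprS expr0; congr (_ *: _); ring.
have bnd : `|annihilator b N F (n%:R ^+ N *: cheb R n)| <= `|C|.
  rewrite -(@ler_pXn2r _ 2) ?nnegrE // real_normK ?num_real //.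
  apply: le_trans (annihilator_sqr_le _ _ _ _) _; apply: l2sq_le => // x hx.
  have := hC _ 1 ler01 (@cheb_le1 R n) x hx.
  rewrite eD !mulr1 -scalerAr iter_avgZ hornerZ !normrM normrX normrN1.
  rewrite expr1n mul1r => h.
  rewrite linearZ /= parity_part_cheb -!scalerAr !iter_avgZ !hornerZ !normrM.
  apply: le_trans (le_trans h (ler_norm _)); rewrite ler_wpM2l //.
  by rewrite ler_piMl // normr_nat lern1 leq_b1.
rewrite -[n%:R ^+ N]ger0_norm ?exprn_ge0 // -normrM.
by move: bnd; rewrite linearZ /= => /le_trans -> //; rewrite lerDl.
Qed.

End Annihilator.

(** * Powers outside the exponent set stay at a distance *)

Section Stability.
Variable R : realType.

(** With D = |m - l| >= 1, the inverse of the factor is at most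
    1 + (2 m + 2 N + 1) / D, and 1 / D <= (m + 1) / l because
    l <= m + D <= (m + 1) D. *)
Lemma blaschke_factor_ge (N m l : nat) : (0 < l)%N -> l != m ->
  expR (- (((m + m + (N + N).+1) * m.+1)%:R / l%:R)) <=
    `|m%:R - l%:R| / (N + m + (N + l)).+1%:R :> R.
Proof.
move=> l0 lm; set A := (_ * _)%N.
have [D [D0 eD lD mD]] : exists D : nat, [/\ (0 < D)%N, `|m%:R - l%:R| = D%:R :> R,
    (l <= m.+1 * D)%N & (l <= m + D)%N].
  have [ml|ml|e] := ltngtP m l; last by rewrite e eqxx in lm.
    exists (l - m)%N; split; [lia| |nia|lia].
    by rewrite distrC ger0_norm ?subr_ge0 ?ler_nat ?(ltnW ml) // natrB // ltnW.
  exists (m - l)%N; split; [lia| |nia|lia].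
  by rewrite ger0_norm ?subr_ge0 ?ler_nat ?(ltnW ml) // natrB // ltnW.
rewrite eD expRN -[X in _ <= X]invf_div.
rewrite lef_pV2 ?posrE ?expR_gt0 ?divr_gt0 ?ltr0n //.
apply: le_trans (expR_ge1Dx _).
rewrite -subr_ge0.
have -> : 1 + A%:R / l%:R - (N + m + (N + l)).+1%:R / D%:R =
    (D * l + A * D - (N + m + (N + l)).+1 * l)%:R / (l%:R * D%:R) :> R.
  rewrite natrB /A; last by nia.
  rewrite !(natrD, natrM, =^~ natr1); field.
  by rewrite !pnatr_eq0 -!lt0n l0 D0.
by rewrite divr_ge0 // -natrM.
Qed.

Lemma sum_inv_sqr_le2 d : \sum_(n < d | (0 < n)%N) (n%:R ^+ 2)^-1 <= 2 :> R.
Proof.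
(* the telescoping bound 1 / n^2 <= 1 / (n - 1) - 1 / n *)
suff h : \sum_(n < d.+2 | (0 < n)%N) (n%:R ^+ 2)^-1 <= 2 - d.+1%:R^-1 :> R.
  apply: le_trans (le_trans h _); last by rewrite gerBl.
  rewrite big_mkcond [leRHS]big_mkcond !big_ord_recr /= -addrA lerDl.
  by rewrite addr_ge0 //; case: ifP.
elim: d => [|d IH].
  by rewrite big_mkcond !big_ord_recr big_ord0 /=; lra.
rewrite big_mkcond big_ord_recr /= -big_mkcond /=.
apply: le_trans (lerD IH (lexx _)) _; rewrite -subr_ge0.
have -> : 2 - d.+2%:R^-1 - (2 - d.+1%:R^-1 + (d.+2%:R ^+ 2)^-1) =
  (d.+1%:R * d.+2%:R ^+ 2)^-1 :> R.
  by rewrite -[d.+2%:R]natr1; field; rewrite nat1r natr1 !pnatr_eq0.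
by rewrite invr_ge0 mulr_ge0 // exprn_ge0.
Qed.

(** The exponent 0 is added to F so that the functional also vanishes on the
    constants; its factor m / (m + 2 N + 1) is treated apart since 1 / l is
    meaningless there. *)
Lemma annihilator_Xn_lower b N m (B : R) : odd m = b -> (0 < m)%N ->
  exists2 delta : R, 0 < delta & forall F : seq nat,
    (forall l, l \in F -> (0 < l)%N && (l != m)) ->
    \sum_(l <- F) l%:R^-1 <= B ->
    delta <= `|annihilator b N (0%N :: F) 'X^m|.
Proof.
move=> mb m0; set A : R := ((m + m + (N + N).+1) * m.+1)%:R.
exists ((N + m).+1%:R^-1 ^+ N.+1 *
        (m%:R / (N + m + (N + 0)).+1%:R * expR (- (A * B)))).
  by rewrite mulr_gt0 ?exprn_gt0 ?invr_gt0 ?mulr_gt0 ?expR_gt0 ?invr_gt0 ?ltr0n.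
move=> F hF hB.
rewrite annihilatorXn mb eqxx mul1r normrM ger0_norm ?exprn_ge0 ?invr_ge0 //.
rewrite ler_wpM2l ?exprn_ge0 ?invr_ge0 //.
rewrite big_cons normrM subr0 ger0_norm ?divr_ge0 // ler_wpM2l ?divr_ge0 //.
have : expR (- (A * \sum_(l <- F) l%:R^-1)) <= 
  `|\prod_(l <- F) ((m%:R - l%:R) / (N + m + (N + l)).+1%:R)|.
  elim: F hF {hB} => [|l F IH] hF.
    by rewrite !big_nil mulr0 oppr0 expR0 normr1.
  rewrite !big_cons mulrDr opprD expRD normrM ler_pM ?expR_ge0 //.
    rewrite normrM normfV [`|_.+1%:R|]ger0_norm //.
    by have /andP[] := hF l (mem_head _ _); exact: blaschke_factor_ge.
  by apply: IH => k kF; apply: hF; rewrite in_cons kF orbT.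
by apply: le_trans; rewrite ler_expR lerN2 ler_wpM2l.
Qed.

(** If the Chebyshev coefficients of P - x^m of index n > 0 are at most E n^2k
    in absolute value, then E cannot be small, whatever P supported in S.  No bound is asked on c_0. *)
Lemma monomial_gap (S : pred nat) b k m (B : R) :
    odd m = b -> (0 < m)%N -> ~~ S m ->
    (forall F : seq nat, uniq F ->
       (forall l, l \in F -> [&& S l, odd l == b & (0 < l)%N]) ->
       \sum_(l <- F) l%:R^-1 <= B) ->
  exists2 eta : R, 0 < eta & forall (P : {poly R}) d (c : nat -> R) E, 0 <= E ->
    (forall i, P`_i != 0 -> S i) ->
    P - 'X^m = \sum_(n < d) c n *: cheb R n ->
    (forall n, (0 < n < d)%N -> `|c n| <= E * n%:R ^+ (2 * k)) ->
    eta <= E.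
Proof.
move=> mb m0 Sm hB.
have [delta delta0 hdelta] := annihilator_Xn_lower (2 * k.+1) B mb m0.
have [C C0 hC] := @annihilator_cheb_decay R b k.+1.
exists (delta / (2 * C)) => [|P d c E E0 hP eP hc].
  by rewrite divr_gt0 ?mulr_gt0.
rewrite ler_pdivrMr ?mulr_gt0 //.
pose F := [seq i <- iota 1 (size P) | (P`_i != 0) && (odd i == b)].
pose L : {poly R} -> R := annihilator b (2 * k.+1) (0%N :: F).
have FE i : i \in F = [&& P`_i != 0, odd i == b & (0 < i)%N].
  rewrite mem_filter mem_iota -andbA; have [//|Pi /=] := eqVneq P`_i 0.
  congr (_ && _); apply: andb_idr => _; rewrite add1n ltnS leqNgt.
  by apply: contra Pi => /ltnW/(nth_default 0) ->.
have LX0 i : i \in 0%N :: F -> L 'X^i = 0.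
  move=> iF; rewrite /L annihilatorXn [X in _ * X]big_mkcond.
  by rewrite (big_rem i iF) /= subrr !mul0r mulr0.
have LP : L P = 0.
  rewrite -[P]coefK poly_def /L linear_sum big1 //= => i _.
  rewrite linearZ /= -/(L _).
  have [->|Pi] := eqVneq P`_i 0; first by rewrite mul0r.
  have [i0|i0] := posnP i; first by rewrite LX0 ?mulr0 // i0 mem_head.
  have [ib|ib] := eqVneq (odd i) b; last first.
    by rewrite /L annihilatorXn (negPf ib) !mul0r mulr0.
  by rewrite LX0 ?mulr0 // in_cons FE Pi ib eqxx i0 orbT.
have : delta <= `|L 'X^m|.
  apply: hdelta => [l|].
    rewrite FE => /and3P[/hP Sl _ ->] /=.
    by apply: contraNneq Sm => <-.
  apply: hB => [|l]; first exact/filter_uniq/iota_uniq.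
  by rewrite FE => /and3P[/hP -> -> ->].
move=> /le_trans -> //.
have -> : L 'X^m = - L (P - 'X^m) by rewrite /L linearB /= -!/(L _) LP sub0r opprK.
rewrite normrN eP /L linear_sum /=.
apply: le_trans (ler_norm_sum _ _ _) _.
apply: (@le_trans _ _
  (\sum_(n < d | (0 < n)%N) (E * C) * (n%:R ^+ 2)^-1)); last first.
  rewrite -mulr_sumr [2 * C]mulrC mulrA.
  by rewrite ler_wpM2l ?mulr_ge0 ?(ltW C0) // sum_inv_sqr_le2.
rewrite [leRHS]big_mkcond; apply: ler_sum => -[[|n] /= nd] _.
  by rewrite linearZ /= -/(L _) cheb0 -(expr0 'X) LX0 ?mem_head // mulr0 normr0.
rewrite linearZ normrM /= -/(L _).
have n0 : 0 < n.+1%:R :> R by rewrite ltr0n.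
have h := hC (0%N :: F) n.+1; rewrite -/(L _) in h.
apply: (@le_trans _ _ (E * n.+1%:R ^+ (2 * k) * `|L (cheb R n.+1)|)).
  by rewrite ler_wpM2r // hc.
rewrite -2!mulrA ler_wpM2l // ler_pdivlMr ?exprn_gt0 //.
by apply: le_trans h; rewrite mulrAC -exprD mulnS addnC.
Qed.

End Stability.

(** * Small divisors *)

Section SmallDivisors.
Variable R : realType.

Lemma normr_sin_shift (x : R) (m : int) : `|sin (x + m%:~R * pi)| = `|sin x|.
Proof.
have shift n (y : R) : `|sin (y + n%:R * pi)| = `|sin y|.
  rewrite mulr_natl (alternatingn (@sinDpi R)) normrM normrX normrN1.
  by rewrite expr1n mul1r.
case: m => n; first exact: shift.
rewrite NegzE mulrNz mulNr -[in RHS](subrK (n.+1%:R * pi) x).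
by rewrite (shift n.+1).
Qed.

(** sin x = 2 cos (x/2) sin (x/2), and on [0, pi/4] the cosine is at least 1/2,
    hence the sine at least half its argument. *)
Lemma sin_ge_quarter (x : R) : 0 <= x <= pi / 2 -> x / 4 <= sin x.
Proof.
move=> /andP[x0 xpi].
have cos_half (y : R) : 0 <= y <= x / 2 -> 1 / 2 <= cos y.
  move=> /andP[y0 yx].
  have c2 : 0 <= cos (y *+ 2).
    by apply: cos_ge0_pihalf; rewrite [y *+ 2]mulr2n; apply/andP; split; lra.
  have c1 : 0 <= cos y by apply: cos_ge0_pihalf; apply/andP; split; lra.
  rewrite cos_mulr2n in c2; nra.
have x20 : 0 <= x / 2 by rewrite divr_ge0.
have csin : {within `[0, x / 2], continuous (@sin R)}.
  by apply: continuous_subspaceT => y; exact: continuous_sin.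
have [c] := MVT_segment x20 (fun y _ => is_derive_sin y) csin.
rewrite in_itv /= sin0 !subr0 => cx e.
have := cos_half c cx; have : 1 / 2 <= cos (x / 2).
  by apply: cos_half; rewrite lexx divr_ge0.
have -> : sin x = (cos (x / 2) * sin (x / 2)) *+ 2.
  by rewrite -sin_mulr2n [x / 2 *+ 2]mulr2n -splitr.
rewrite e => c1 c2; have : 1 / 4 <= cos (x / 2) * cos c by nra.
move=> /(ler_wpM2r x0); lra.
Qed.

Lemma seq_pos_lower_bound (T : choiceType) (s : seq T) (v : T -> R) :
  (forall x, x \in s -> 0 < v x) ->
  exists2 c, 0 < c & forall x, x \in s -> c <= v x.
Proof.
elim: s => [|y s IH] vpos; first by exists 1.
have [x xs|c c0 hc] := IH; first by apply: vpos; rewrite in_cons xs orbT.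
exists (Num.min c (v y)); first by rewrite lt_min c0 vpos ?mem_head.
move=> x; rewrite in_cons ge_min => /predU1P[->|/hc ->//].
by rewrite lexx orbT.
Qed.

(** The finitely many exceptional pairs of [approximable] contribute a positive
    minimum, by irrationality.  Real powers n^-a are weakened to n^-2k with
    2 k >= a, an even exponent because [cheb_op] gains n^2 at a time. *)
Lemma approximable_lower_bound (theta a : R) :
  irrational theta -> 0 < a -> approximable a theta ->
  exists (k : nat) (c : R), 0 < c /\ forall (m : int) (n : nat), (0 < n)%N ->
    c <= `|m%:~R - n%:R * theta| * n%:R ^+ (2 * k).
Proof.
move=> irr a0 [C C0 /finite_seqP[s es]].
pose k := (Num.truncn a).+1.
have powa n : (0 < n)%N -> 1 <= n%:R `^ (- a) * n%:R ^+ (2 * k) :> R.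
  move=> n0; have n1 : 1 <= n%:R :> R by rewrite ler1n.
  rewrite -powR_mulrn ?ler0n // -powRD; last by rewrite pnatr_eq0 gtn_eqF ?implybT.
  rewrite -[leLHS](powRr0 n%:R) ler_powR // addrC subr_ge0.
  rewrite (le_trans (ltW (truncnS_gt a))) //.
  by rewrite ler_nat -/k leq_pmull.
have dist_gt0 (m : int) (n : nat) : (0 < n)%N -> 0 < `|m%:~R - n%:R * theta|.
  move=> n0; rewrite normr_gt0; apply/eqP => /subr0_eq e.
  apply: irr; apply/rationalP; exists m, n.
  by rewrite e [_ * theta]mulrC mulfK // pnatr_eq0 -lt0n.
pose v (mn : int * int) : R :=
  `|mn.1%:~R - mn.2%:~R * theta| * mn.2%:~R ^+ (2 * k).
have [|c c0 hc] := @seq_pos_lower_bound _ s v.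
  move=> [m n] mns; have : [set` s] (m, n) by exact: mns.
  rewrite -es /v /= => -[n1 _]; case: n n1 {mns} => // n n1.
  by rewrite mulr_gt0 ?dist_gt0 ?exprn_gt0 ?ltr0n.
exists k, (Num.min c C); split=> [|m n n0]; first by rewrite lt_min c0.
have [mns|mnNs] := boolP ((m, Posz n) \in s).
  by rewrite ge_min (hc (m, Posz n)).
rewrite ge_min; apply/orP; right.
have far : C * n%:R `^ (- a) <= `|m%:~R - n%:R * theta|.
  rewrite leNgt; apply: contra mnNs => near.
  suff : [set` s] (m, Posz n) by [].
  by rewrite -es.
apply: le_trans (ler_wpM2r _ far); last by rewrite exprn_ge0.
by rewrite -mulrA ler_peMr ?powa // ltW.
Qed.

(** |sin (pi x)| is at least half the distance from x to the nearest integer,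
    applied to x = 2 n theta. *)
Lemma sin_small_divisors (theta a : R) :
  irrational theta -> 0 < a -> approximable a theta ->
  exists (k : nat) (c : R), 0 < c /\ forall n : nat, (0 < n)%N ->
    c <= `|sin (2 * pi * (n%:R * theta))| * n%:R ^+ (2 * k).
Proof.
move=> irr a0 app.
have [k [c [c0 hc]]] := approximable_lower_bound irr a0 app.
exists k, (c / (2 * 2 ^+ (2 * k))); split => [|n n0].
  by rewrite divr_gt0 ?mulr_gt0 ?exprn_gt0.
set x := 2 * n%:R * theta.
(* m is the integer nearest to x *)
pose m := Num.floor (x + 1 / 2); pose r := x - m%:~R.
have r2 : `|r| <= 1 / 2.
  have h1 := floor_le (x + 1 / 2); have := floorD1_gt (x + 1 / 2).
  rewrite -/m intrD in h1 * => h2.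
  by rewrite ler_norml /r; apply/andP; split; lra.
have pi2 : 2 <= pi :> R by exact: pi_ge2.
have sr : `|r| / 2 <= `|sin (2 * pi * (n%:R * theta))|.
  have -> : 2 * pi * (n%:R * theta) = r * pi + m%:~R * pi by rewrite /r /x; ring.
  rewrite normr_sin_shift.
  have -> : `|sin (r * pi)| = `|sin (`|r| * pi)|.
    by case: (ger0P r) => // _; rewrite mulNr sinN normrN.
  apply: le_trans (ler_norm _); apply: le_trans (sin_ge_quarter _).
    have := normr_ge0 r; nra.
  by have r0 := normr_ge0 r; apply/andP; split; nra.
rewrite ler_pdivrMr ?mulr_gt0 ?exprn_gt0 //.
have := hc m (2 * n)%N; rewrite muln_gt0 n0 => /(_ isT).
rewrite natrM -/x exprMn distrC -/r.
have : 0 <= n%:R ^+ (2 * k) :> R by rewrite exprn_ge0.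
have : 0 <= 2 ^+ (2 * k) :> R by rewrite exprn_ge0.
set u := _ ^+ _; set w := _ ^+ _ => u0 w0 /le_trans; apply.
have := mulr_ge0 u0 w0.
rewrite (_ : _ * w * (2 * u) =
  `|sin (2 * pi * (n%:R * theta))| * 2 * (u * w)); last by ring.
by move=> uw; rewrite ler_wpM2r //; lra.
Qed.

End SmallDivisors.

(** * Means of trigonometric functions over a period *)

Section Mean.
Variable R : realType.

(** The integral of u over [0, 1] is v, witnessed by a primitive; in this form
    linearity needs no integrability side condition. *)
Definition has_mean (u : R -> R) (v : R) := exists U : R -> R,
  (forall t : R, is_derive t 1 U (u t)) /\ U 1 - U 0 = v.

Lemma eq_has_mean u1 u2 v1 v2 :
  has_mean u1 v1 -> u1 =1 u2 -> v1 = v2 -> has_mean u2 v2.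
Proof. by move=> + /funext <- <-. Qed.

Lemma has_mean_sum d (c : nat -> R) (u : nat -> R -> R) (v : nat -> R) :
  (forall n, has_mean (u n) (v n)) ->
  has_mean (fun t => \sum_(n < d) c n * u n t) (\sum_(n < d) c n * v n).
Proof.
move=> /choice[U hU].
exists (fun t => \sum_(n < d) c n * U n t); split=> [t|]; last first.
  by rewrite -sumrB; apply: eq_bigr => i _; rewrite -mulrBr (hU i).2.
elim: d => [|d IH].
  under eq_fun do rewrite big_ord0; rewrite big_ord0; exact: is_derive_cst.
under eq_fun do rewrite big_ord_recr /=; rewrite big_ord_recr /=.
have dU : is_derive t 1 (U d) (u d t) by exact: (hU d).1.
apply: is_deriveD.
Qed.

Lemma has_meanD u1 v1 u2 v2 : has_mean u1 v1 -> has_mean u2 v2 ->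
  has_mean (fun t => u1 t + u2 t) (v1 + v2).
Proof.
move=> [U1 [d1 <-]] [U2 [d2 <-]]; exists (fun t => U1 t + U2 t).
by split=> [t|]; [exact: is_deriveD | rewrite opprD addrACA].
Qed.

Lemma cos_shift (x : R) (z : int) : cos (z%:~R * (2 * pi) + x) = cos x.
Proof.
have shift n (y : R) : cos (n%:R * (2 * pi) + y) = cos y.
  elim: n => [|n IH]; first by rewrite mul0r add0r.
  rewrite -[RHS]IH -[RHS]cosD2pi -natr1 -[pi *+ 2]mulr_natl; congr cos; ring.
case: z => n; first exact: shift.
rewrite NegzE mulrNz mulNr -[in RHS](subrKC (n.+1%:R * (2 * pi)) x).
by rewrite (shift n.+1) addrC.
Qed.

Lemma has_mean_sin (z : int) (c : R) :
  has_mean (fun t => sin (z%:~R * (2 * pi) * t + c)) (if z == 0 then sin c else 0).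
Proof.
have [->|z0] := eqVneq z 0.
  exists (fun t => sin c * t); split=> [t|]; last by rewrite mulr1 mulr0 subr0.
  rewrite !mul0r add0r -[X in is_derive _ _ _ X]mulr1.
  by apply: is_deriveZ.
have w0 : z%:~R * (2 * pi) != 0 :> R.
  by rewrite !mulf_neq0 ?intr_eq0 ?pnatr_eq0 // gt_eqF // pi_gt0.
set w := z%:~R * (2 * pi) in w0 *.
exists (fun t => (- w^-1) * cos (w * t + c)); split=> [t|]; last first.
  by rewrite mulr1 mulr0 add0r cos_shift subrr.
have dl : is_derive t 1 (fun t => w * t + c) w.
  rewrite -[X in is_derive _ _ _ X]addr0 -[X in X + 0]mulr1.
  by apply: is_deriveD; apply: is_deriveZ.
have -> : sin (w * t + c) = (- w^-1) * (- sin (w * t + c) * w).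
  by field.
apply: is_deriveZ.
Qed.

(** Product-to-sum: the frequency n + k never vanishes, and n - k only for
    k = n. *)
Lemma has_mean_cos_sin (k n : nat) (th1 th2 : R) : (0 < n)%N ->
  has_mean (fun t => cos (k%:R * (2 * pi * (t - th1))) *
                     sin (n%:R * (2 * pi * (t - th2))))
       (if k == n then sin (2 * pi * (n%:R * (th1 - th2))) / 2 else 0).
Proof.
move=> n0.
pose cp := - (2 * pi * (n%:R * th2 + k%:R * th1)).
pose cm := 2 * pi * (k%:R * th1 - n%:R * th2).
have h1 := has_mean_sin (n + k)%N cp; have h2 := has_mean_sin (n%:Z - k%:Z) cm.
pose u (i : nat) t : R := if i is 0%N
  then sin ((n + k)%N%:Z%:~R * (2 * pi) * t + cp)
  else sin ((n%:Z - k%:Z)%:~R * (2 * pi) * t + cm).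
pose v (i : nat) : R := if i is 0%N
  then (if (n + k)%N%:Z == 0 then sin cp else 0)
  else (if n%:Z - k%:Z == 0 then sin cm else 0).
have uv i : has_mean (u i) (v i) by case: i.
have [U [dU eU]] := has_mean_sum 2 (fun=> 2^-1) uv; exists U; split=> [t|].
  have := dU t; rewrite !big_ord_recl big_ord0 /=.
  suff -> : 2^-1 * sin ((n + k)%:~R * (2 * pi) * t + cp) +
     (2^-1 * sin ((n%:Z - k%:Z)%:~R * (2 * pi) * t + cm) + 0) =
    cos (k%:R * (2 * pi * (t - th1))) * sin (n%:R * (2 * pi * (t - th2))) by [].
  have -> : (n + k)%:~R * (2 * pi) * t + cp =
     n%:R * (2 * pi * (t - th2)) + k%:R * (2 * pi * (t - th1)).
    by rewrite /cp PoszD intrD; ring.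
  have -> : (n%:Z - k%:Z)%:~R * (2 * pi) * t + cm =
     n%:R * (2 * pi * (t - th2)) - k%:R * (2 * pi * (t - th1)).
    by rewrite /cm intrB; ring.
  by rewrite sinD sinB; field.
rewrite eU !big_ord_recl big_ord0 /= eqz_nat addn_eq0 gtn_eqF //= mulr0 add0r addr0.
rewrite subr_eq0 eqz_nat [n == k]eq_sym.
have [e|_] := eqVneq k n; last by rewrite mulr0.
by rewrite mulrC /cm e; congr (sin _ / _); ring.
Qed.

End Mean.

(** * Means are controlled by the norm of X_p *)

Section MeanBound.
Variable R : realType.
Local Notation mu := (@lebesgue_measure R).

(** A substitute for the inclusion of L^p in L^1: if y > e then
    y / e <= (y / e)^r. *)
Lemma le_add_powR (e r y : R) : 0 < e -> 1 <= r -> 0 <= y ->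
  y <= e + e / e `^ r * y `^ r.
Proof.
move=> e0 r1 y0; have [ye|ey] := leP y e.
  by rewrite (le_trans ye) // lerDl mulr_ge0 ?powR_ge0 // divr_ge0 ?powR_ge0 // ltW.
apply: (@le_trans _ _ (e / e `^ r * y `^ r)); last by rewrite lerDr ltW.
rewrite -mulrA [_^-1 * _]mulrC.
have -> : y `^ r / e `^ r = (y / e) `^ r.
  rewrite powRM ?invr_ge0 ?(ltW e0) // -[in RHS]powR_inv1 ?(ltW e0) //.
  by rewrite -powRrM mulN1r powRN.
rewrite -ler_pdivrMl // mulrC; apply: le1r_powR => //.
by rewrite ler_pdivlMr // mul1r ltW.
Qed.

Lemma integral_lebesgue01_ge (f : measurableTypeR R -> \bar R) :
  measurable_fun setT f -> (forall x, 0 <= f x)%E ->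
  (\int[mu]_(x in `]0%R, 1%R[) f x <= \int[lebesgue01]_x f x)%E.
Proof.
move=> mf f0.
have <- : (\int[lebesgue01]_(x in `]0%R, 1%R[) f x =
           \int[mu]_(x in `]0%R, 1%R[) f x)%E.
  apply: eq_measure_integral => A mA sA.
  by rewrite /lebesgue01 /= /mrestr setIidl.
apply: ge0_subset_integral => //.
Qed.

Lemma Lnorm_lt_integral (r e : R) (H : measurableTypeR R -> R) :
  1 <= r -> 0 < e ->
  measurable_fun setT H -> (forall x, 0 <= H x) ->
  (Lnorm (@lebesgue01 R) r%:E (EFin \o H) < e%:E)%E ->
  (\int[mu]_(x in `]0%R, 1%R[) (H x `^ r)%:E <= (e `^ r)%:E)%E.
Proof.
move=> r1 e0 mH H0 lt_e; have r0 : r != 0 by rewrite gt_eqF // (lt_le_trans ltr01).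
have mHr : measurable_fun setT (fun x => (H x `^ r)%:E).
  apply/measurable_EFinP.
  exact: (@measurableT_comp _ _ _ _ _ _ (@powR R ^~ r)).
apply: le_trans (integral_lebesgue01_ge mHr _) _.
  by move=> x; rewrite lee_fin powR_ge0.
rewrite -poweR_EFin.
have <- : (Lnorm (@lebesgue01 R) r%:E (EFin \o H) `^ r =
   \int[lebesgue01]_x (H x `^ r)%:E)%E.
  rewrite poweR_Lnorm //; apply: eq_integral => x _ /=.
  by rewrite ger0_norm.
apply: gt0_ler_poweR (ltW lt_e); first exact: le_trans ler01 r1.
  by rewrite in_itv /= Lnorm_ge0 leey.
by rewrite in_itv /= lee_fin (ltW e0) leey.
Qed.

(** For finite p, integrate [le_add_powR] with y = |h|: when the p-norm of h is
    less than e, both terms of the right-hand side integrate to at most e. *)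
Lemma has_mean_le_Xnorm (p : \bar R) (h : R -> R[i]) (u : R -> R) (v e : R) :
  (1 <= p)%E -> 0 < e ->
  measurable_fun setT (modulus h : measurableTypeR R -> R) ->
  continuous u -> has_mean u v -> (forall t, `|u t| <= modulus h t) ->
  (Xnorm p h < e%:E)%E -> `|v| <= 2 * e.
Proof.
move=> p1 e0 mh cu [U [dU eU]] uh.
have cU : {within `[0, 1], continuous U}.
  apply: continuous_subspaceT => t; apply: differentiable_continuous.
  by apply/derivable1_diffP; exact: ex_derive.
rewrite /Xnorm; case: ifPn => [_ he|pNy he].
  have [c _] := MVT_segment ler01 (fun t _ => dU t) cU.
  rewrite eU subr0 mulr1 => ->; rewrite (le_trans (uh c)) // ltW //.
  apply: (@lt_trans _ _ e); last by rewrite ltr_pMl // ltr1n.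
  rewrite -lte_fin; apply: le_lt_trans he; apply: ereal_sup_ubound.
  by exists c.
case: p p1 pNy he => [r| |] // r1 _ he; rewrite lee_fin in r1.
have modulus_ge0 t : 0 <= modulus h t by exact: le_trans (uh t).
have int_h := Lnorm_lt_integral r1 e0 mh modulus_ge0 he.
have mu_u : measurable_fun setT (u : measurableTypeR R -> R).
  exact: continuous_measurable_fun.
have eint : (\int[@lebesgue_measure R]_(t in `]0%R, 1%R[) (u t)%:E = v%:E)%E.
  rewrite -(@integral_itv_bndoo _ _ _ _ true false); last first.
    by apply: measurable_funTS; exact/measurable_EFinP.
  rewrite (@continuous_FTC2 _ u U) // ?ltr01 //.
  - by rewrite -EFinB eU.
  - exact: continuous_subspaceT.
  - have dUU t : derivable U t 1 by exact: ex_derive.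
    have ctU t : {for t, continuous U}.
      by apply: differentiable_continuous; apply/derivable1_diffP.
    split=> //.
    + exact: cvg_at_right_filter (ctU 0).
    + exact: cvg_at_left_filter (ctU 1).
  - by move=> t _; rewrite derive1E derive_val.
rewrite -lee_fin -[X in (X <= _)%E]abse_EFin -eint.
apply: le_trans (le_abse_integral _ _ _) _ => //.
  by apply: measurable_funTS; exact/measurable_EFinP.
have mhr : measurable_fun setT (fun t : measurableTypeR R => modulus h t `^ r).
  exact: (@measurableT_comp _ _ _ _ _ _ (@powR R ^~ r)).
apply: (@le_trans _ _ (\int[@lebesgue_measure R]_(t in `]0%R, 1%R[)
   (e%:E + (e / e `^ r)%:E * (modulus h t `^ r)%:E))%E).
  apply: ge0_le_integral => //.
  - by apply: measurable_funTS; do 2 apply: measurableT_comp => //.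
  - apply: emeasurable_funD => //; apply: measurable_funeM.
    by apply: measurable_funTS; exact/measurable_EFinP.
  - move=> t _; rewrite -EFinM -EFinD /= lee_fin (le_trans (uh t)) //.
    exact: le_add_powR.
rewrite ge0_integralD //=; last 3 first.
- by move=> t _; rewrite lee_fin ltW.
- by move=> t _; rewrite lee_fin mulr_ge0 ?powR_ge0 // divr_ge0 ?powR_ge0 // ltW.
- apply: measurable_funeM.
  by apply: measurable_funTS; exact/measurable_EFinP.
rewrite integral_cst //= lebesgue_measure_itv /= lte_fin ltr01 oppr0 adde0 mule1.
rewrite ge0_integralZl //=; last 3 first.
- by apply: measurable_funTS; exact/measurable_EFinP.
- by move=> t _; rewrite lee_fin powR_ge0.
- by rewrite lee_fin divr_ge0 ?powR_ge0 // ltW.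
rewrite [2 * e]mulr_natl [e *+ 2]mulr2n EFinD leeD2l //.
apply: (@le_trans _ _ ((e / e `^ r)%:E * (e `^ r)%:E)%E).
  by rewrite lee_pmul2l // lte_fin divr_gt0 // powR_gt0.
by rewrite -EFinM divfK // gt_eqF // powR_gt0.
Qed.

End MeanBound.

(** * The powers of cosines and their span *)

Section CosPow.
Variable R : realType.

Lemma le_Re_modulus (f : R -> R[i]) t : `|complex.Re (f t)| <= modulus f t.
Proof.
rewrite /modulus; case: (f t) => x y /=.
by rewrite -sqrtr_sqr ler_wsqrtr // lerDl sqr_ge0.
Qed.

Lemma continuous_cos_affine (theta : R) :
  continuous (fun t : R => cos (2 * pi * (t - theta))).
Proof.
move=> t; apply: (@continuous_comp _ _ _ (fun t => 2 * pi * (t - theta)) cos).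
  apply: continuousM; first exact: cvg_cst.
  by apply: continuousB => //; exact: cvg_cst.
exact: continuous_cos.
Qed.

Lemma continuous_horner_cos (P : {poly R}) (theta : R) :
  continuous (fun t : R => P.[cos (2 * pi * (t - theta))]).
Proof.
move=> t; apply: (@continuous_comp _ _ _ _ (fun x => P.[x])).
  exact: continuous_cos_affine.
exact: continuous_horner.
Qed.

Lemma continuous_real_complex (f : R -> R) :
  continuous f -> continuous (fun t => (f t)%:C%C : R[i]^o).
Proof.
move=> cf t; apply/cvgrPdist_lt => /= -[e e'].
rewrite ltcE /= => /andP[/eqP -> e0].
have /cvgrPdist_lt/(_ e e0) := cf t.
apply: filterS => x; rewrite -rmorphB normc_def /= expr0n addr0 sqrtr_sqr.
by rewrite ltcE /= eqxx.
Qed.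

Lemma measurable_modulus (f : R -> R[i]) :
  measurable_fun setT (fun t : measurableTypeR R => complex.Re (f t)) ->
  measurable_fun setT (fun t : measurableTypeR R => complex.Im (f t)) ->
  measurable_fun setT (modulus f : measurableTypeR R -> R).
Proof.
move=> mRe mIm.
have -> : modulus f =
    fun t => Num.sqrt (complex.Re (f t) ^+ 2 + complex.Im (f t) ^+ 2).
  by apply/funext => t; rewrite /modulus; case: (f t).
apply: (@measurableT_comp _ _ _ _ _ _ (@Num.sqrt R)).
  exact: continuous_measurable_fun (@sqrt_continuous R).
by apply: measurable_funD; exact: measurable_funX.
Qed.

Lemma cos_pow_in_X (p : \bar R) (theta : R) m :
  (1 <= p)%E -> X p (cos_pow theta m).
Proof.
move=> p1; split=> [t|].
  rewrite /cos_pow; congr ((_ ^+ _)%:C%C).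
  by rewrite -[RHS](cos_shift _ 1); congr cos; ring.
have ccos : continuous (fun t : R => cos (2 * pi * (t - theta)) ^+ m).
  have := @continuous_horner_cos 'X^m theta.
  by under eq_fun do rewrite hornerXn.
case: ifPn => [_|pNy]; first exact: continuous_real_complex.
case: p p1 pNy => [r| |] // r1 _; rewrite lee_fin in r1.
have mRe : measurable_fun setT
    (fun t : measurableTypeR R => complex.Re (cos_pow theta m t)).
  exact: continuous_measurable_fun.
have mIm : measurable_fun setT
    (fun t : measurableTypeR R => complex.Im (cos_pow theta m t)).
  exact: measurable_cst.
have mmod := measurable_modulus mRe mIm.
split=> //; rewrite inE; apply/andP; split; rewrite inE //=.
have r0 : r != 0 by rewrite gt_eqF // (lt_le_trans ltr01).
rewrite /finite_norm; apply: (lty_poweRy r0); rewrite poweR_Lnorm //.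
have -> :
  (\int[@lebesgue01 R]_x (`|(EFin \o modulus (cos_pow theta m)) x| `^ r) =
   \int[@lebesgue01 R]_x (`|modulus (cos_pow theta m) x| `^ r)%:E)%E by [].
apply: (@le_lt_trans _ _ (\int[@lebesgue01 R]_x (cst 1%E x))%E).
  apply: ge0_le_integral => //=.
  - apply/measurable_EFinP.
    have mnorm : measurable_fun setT
        (fun t : measurableTypeR R => `|modulus (cos_pow theta m) t|).
      exact: measurableT_comp.
    exact: (@measurableT_comp _ _ _ _ _ _ (@powR R ^~ r)).
  - move=> t _; rewrite lee_fin; apply: (@le_trans _ _ (1 `^ r)).
      apply: ge0_ler_powR (le_trans ler01 r1) _ _ _ _ _; rewrite ?nnegrE //.
      rewrite /modulus /= expr0n /= addr0 sqrtr_sqr normr_id normrX.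
      by rewrite exprn_ile1 // cos_max.
    by rewrite powR1.
rewrite integral_cst //= mul1e /lebesgue01 /= /mrestr setTI.
by rewrite lebesgue_measure_itv /= lte_fin ltr01 oppr0 adde0 ltry.
Qed.

(** Real and imaginary parts are separated so that everything that follows
    concerns real polynomials; the imaginary part serves only the
    measurability of the modulus of the error. *)
Lemma lin_span_cos_pow (Lambda : set nat) (th1 th2 : R) (g : R -> R[i]) :
  lin_span ([set cos_pow th1 l | l in Lambda] `|`
            [set cos_pow th2 l | l in Lambda]) g ->
  exists P Q P' Q' : {poly R}, [/\ forall i, P`_i != 0 -> Lambda i,
    forall t, complex.Re (g t) =
      P.[cos (2 * pi * (t - th1))] + Q.[cos (2 * pi * (t - th2))] &
    forall t, complex.Im (g t) =
      P'.[cos (2 * pi * (t - th1))] + Q'.[cos (2 * pi * (t - th2))]].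
Proof.
move=> [n [c [phi [hphi ->]]]].
elim: n c phi hphi => [|n IH] c phi hphi.
  exists 0, 0, 0, 0; split=> [i|t|t]; rewrite ?coef0 ?eqxx //;
    by rewrite big_ord0 !horner0 addr0.
have [//|P [Q [P' [Q' [hP hRe hIm]]]]] :=
  IH (c \o widen_ord (leqnSn n)) (phi \o widen_ord (leqnSn n)).
  by move=> k; exact: hphi.
have ReM (z : R[i]) (x : R) : complex.Re (z * (x%:C)%C) = complex.Re z * x.
  by case: z => a b /=; rewrite mulr0 subr0.
have ImM (z : R[i]) (x : R) : complex.Im (z * (x%:C)%C) = complex.Im z * x.
  by case: z => a b /=; rewrite mulr0 add0r.
have ReD (z w : R[i]) : complex.Re (z + w) = complex.Re z + complex.Re w.
  by case: z w => ? ? [].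
have ImD (z w : R[i]) : complex.Im (z + w) = complex.Im z + complex.Im w.
  by case: z w => ? ? [].
have := hphi ord_max; set z := c ord_max => -[] [l Ll el].
  exists (P + complex.Re z *: 'X^l), Q, (P' + complex.Im z *: 'X^l), Q'.
  split=> [i|t|t].
  - rewrite coefD coefZ coefXn; have [->//|_] := eqVneq i l.
    by rewrite mulr0 addr0; exact: hP.
  - rewrite big_ord_recr /= ReD hRe -el /cos_pow ReM.
    by rewrite hornerD hornerZ hornerXn; ring.
  - rewrite big_ord_recr /= ImD hIm -el /cos_pow ImM.
    by rewrite hornerD hornerZ hornerXn; ring.
exists P, (Q + complex.Re z *: 'X^l), P', (Q' + complex.Im z *: 'X^l).
split=> // t.
- rewrite big_ord_recr /= ReD hRe -el /cos_pow ReM.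
  by rewrite hornerD hornerZ hornerXn; ring.
- rewrite big_ord_recr /= ImD hIm -el /cos_pow ImM.
  by rewrite hornerD hornerZ hornerXn; ring.
Qed.

End CosPow.

(** * Sums of reciprocals over a parity class *)

Section Sums.
Variable R : realType.

Lemma esum_finite_bound (S : set nat) :
  \esum_(l in S) (l%:R^-1 : R)%:E <> +oo%E ->
  exists B : R, forall F : seq nat, uniq F -> (forall l, l \in F -> S l) ->
    \sum_(l <- F) l%:R^-1 <= B.
Proof.
set s := (X in X <> _) => sNy.
have s0 : (0 <= s)%E by apply: esum_ge0 => l _; rewrite lee_fin invr_ge0.
exists (fine s) => F uF FS.
rewrite -lee_fin fineK; last by rewrite ge0_fin_numE // ltey; exact/eqP.
apply: esum_ge; exists [set` F]; last by rewrite -fsbig_seq // sumEFin.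
by split=> //; exact: finite_seq.
Qed.

(** Otherwise Lambda would contain all positive integers of the given parity,
    and the harmonic series would be bounded by 2 B. *)
Lemma parity_class_avoids (Lambda : set nat) (b : bool) (B : R) :
  (forall F : seq nat, uniq F ->
     (forall l, l \in F -> [/\ Lambda l, odd l = b & l != 0%N]) ->
     \sum_(l <- F) l%:R^-1 <= B) ->
  exists m, [/\ odd m = b, (0 < m)%N & ~ Lambda m].
Proof.
move=> hB; apply: contrapT => noM; apply: (@dvg_harmonic R).
pose e i := (i.*2 + ~~ b).+1.
have eE i : [/\ Lambda (e i), odd (e i) = b & e i != 0%N].
  have eb : odd (e i) = b by rewrite /e /= oddD odd_double oddb negbK.
  by split=> //; apply: contrapT => nL; apply: noM; exists (e i).
apply: nondecreasing_is_cvgn.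
  by apply: nondecreasing_series => i _ _; exact: harmonic_ge0.
exists (2 * B) => _ [n _ <-].
have inj_e : injective e.
  by move=> i j; rewrite /e; case: b {hB noM e eE} => /=; lia.
have := hB [seq e i | i <- iota 0 n].
rewrite map_inj_uniq // iota_uniq => /(_ isT) h.
have {h}h : \sum_(l <- [seq e i | i <- iota 0 n]) l%:R^-1 <= B.
  by apply: h => _ /mapP[i _ ->].
rewrite seriesEnat /=; apply: (le_trans _ (ler_wpM2l _ h)) => //.
rewrite big_map mulr_sumr /index_iota subn0; apply: ler_sum => i _.
rewrite -[2]invrK -invfM lef_pV2 ?posrE ?ltr0n //; last first.
  by rewrite mulr_gt0 ?invr_gt0 ?ltr0n.
rewrite ler_pdivrMl // -natrM ler_nat /e.
by case: b {hB noM e eE inj_e h} => /=; lia.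
Qed.

End Sums.

(** * Necessity of the divergence conditions *)

Section Converse.
Variable R : realType.

(** The test function is odd about th2 and the second sum is even about th2:
    only the coefficient of T_n in the first sum survives. *)
Lemma has_mean_cheb_sum d (c1 c2 : nat -> R) (th1 th2 : R) n : (0 < n < d)%N ->
  has_mean (fun t => ((\sum_(k < d) c1 k *: cheb R k).[cos (2 * pi * (t - th1))] +
                  (\sum_(k < d) c2 k *: cheb R k).[cos (2 * pi * (t - th2))]) *
                 sin (n%:R * (2 * pi * (t - th2))))
       (c1 n * (sin (2 * pi * (n%:R * (th1 - th2))) / 2)).
Proof.
move=> /andP[n0 nd].
have part (c : nat -> R) th :
  has_mean (fun t => (\sum_(k < d) c k *: cheb R k).[cos (2 * pi * (t - th))] *
                 sin (n%:R * (2 * pi * (t - th2))))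
       (c n * (sin (2 * pi * (n%:R * (th - th2))) / 2)).
  have Hs := has_mean_sum d c (fun k => has_mean_cos_sin k th th2 n0).
  apply: (eq_has_mean Hs) => [t|].
    rewrite horner_sum mulr_suml; apply: eq_bigr => k _.
    by rewrite hornerZ cheb_cos mulrA.
  rewrite (bigD1 (Ordinal nd)) //= eqxx big1 ?addr0 // => k kn.
  by rewrite ifN ?mulr0 //; apply: contra kn => /eqP e; apply/eqP/val_inj.
apply: (eq_has_mean (has_meanD (part c1 th1) (part c2 th2))) => [t|].
  exact/esym/mulrDl.
by rewrite subrr !mulr0 sin0 mul0r mulr0 addr0.
Qed.

Lemma total_parity_esum (p : \bar R) (Lambda : set nat) (th1 th2 a : R)
    (b : bool) :
  (1 <= p)%E -> irrational (th1 - th2) -> 0 < a -> approximable a (th1 - th2) ->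
  total_in p ([set cos_pow th1 l | l in Lambda] `|`
              [set cos_pow th2 l | l in Lambda]) ->
  \esum_(l in [set l | [/\ Lambda l, odd l = b & l != 0%N]])
    (l%:R^-1 : R)%:E = +oo%E.
Proof.
move=> p1 irr a0 app [_ dense]; apply: contrapT => /esum_finite_bound[B hB].
have [m [mb m0 mL]] := parity_class_avoids hB.
have [k [c0 [c0_gt0 hsin]]] := sin_small_divisors irr a0 app.
have [||eta eta0 gap] := @monomial_gap R (fun l => `[< Lambda l >]) b k m B mb m0.
- exact/asboolPn.
- move=> F uF hF; apply: hB => // l /hF/and3P[/asboolP Ll /eqP lb l0].
  by split=> //; rewrite -lt0n.
(* chosen so that the bound 4 e / c0 on the coefficients is eta / 2 *)
pose e := eta * c0 / 8.
have e0 : 0 < e by rewrite !mulr_gt0 ?invr_gt0.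
have [g /lin_span_cos_pow[P [Q [P' [Q' [hP hRe hIm]]]]] hnorm] :=
  dense _ (cos_pow_in_X th1 m p1) e e0.
set h := (fun t => _ - _) in hnorm.
pose d := maxn (size (P - 'X^m)) (size Q).
have [c1 ec1] := @cheb_expand R d (P - 'X^m) (leq_maxl _ _).
have [c2 ec2] := @cheb_expand R d Q (leq_maxr _ _).
have Reh t : complex.Re (h t) = - ((P - 'X^m).[cos (2 * pi * (t - th1))] +
                             Q.[cos (2 * pi * (t - th2))]).
  rewrite /h /cos_pow; have := hRe t; case: (g t) => x y /= ->.
  by rewrite hornerD hornerN hornerXn; ring.
have Imh t : complex.Im (h t) = - (P'.[cos (2 * pi * (t - th1))] +
                             Q'.[cos (2 * pi * (t - th2))]).
  by rewrite /h /cos_pow; have := hIm t; case: (g t) => x y /= ->; rewrite sub0r.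
have mtwin (U V : {poly R}) : measurable_fun setT (fun t : measurableTypeR R =>
    - (U.[cos (2 * pi * (t - th1))] + V.[cos (2 * pi * (t - th2))])).
  apply: continuous_measurable_fun => t; apply: cvgN.
  by apply: cvgD; exact: continuous_horner_cos.
have mh : measurable_fun setT (modulus h : measurableTypeR R -> R).
  apply: measurable_modulus; first by under eq_fun do rewrite Reh; exact: mtwin.
  by under eq_fun do rewrite Imh; exact: mtwin.
have : eta <= 4 * e / c0.
  apply: (gap P d c1); first by apply: divr_ge0; [exact/mulr_ge0/ltW | exact: ltW].
  - by move=> i /hP Li; exact/asboolP.
  - exact: ec1.
  move=> n nd; have n0 : (0 < n)%N by case/andP: nd.
  have := has_mean_cheb_sum c1 c2 th1 th2 nd; rewrite -ec1 -ec2.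
  set s := sin _; set u := (fun t => _ * _) => mu_u.
  have cu : continuous u.
    move=> t; apply: cvgM.
      by apply: cvgD; exact: continuous_horner_cos.
    apply: (@continuous_comp _ _ _ (fun t => n%:R * (2 * pi * (t - th2))) sin).
      apply: continuousM; first exact: cvg_cst.
      apply: continuousM; first exact: cvg_cst.
      by apply: continuousB => //; exact: cvg_cst.
    exact: continuous_sin.
  have uh t : `|u t| <= modulus h t.
    rewrite /u normrM; apply: le_trans (le_Re_modulus h t).
    by rewrite Reh normrN ler_piMr // sin_max.
  have := has_mean_le_Xnorm p1 e0 mh cu mu_u uh hnorm.
  rewrite !normrM normfV [`|2|]ger0_norm // => hc.
  have := hsin n n0; rewrite -/s => hs.
  rewrite mulrAC ler_pdivlMr //.
  apply: le_trans (ler_wpM2l (normr_ge0 _) hs) _.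
  rewrite mulrA ler_wpM2r ?exprn_ge0 //; lra.
by rewrite ler_pdivlMr // /e; have := mulr_gt0 eta0 c0_gt0; lra.
Qed.

End Converse.

Theorem theorem4p7 (R : realType) (p : \bar R) (Lambda : set nat)
    (theta1 theta2 a : R) :
  (1 <= p)%E ->
  0 <= theta1 < 1 -> 0 <= theta2 < 1 ->
  irrational (theta1 - theta2) ->
  0 < a -> approximable a (theta1 - theta2) ->
  total_in p ([set cos_pow theta1 l | l in Lambda] `|`
              [set cos_pow theta2 l | l in Lambda]) ->
  Muntz_Szasz R (0%N |` Lambda).
Proof.
move=> p1 _ _ irr a0 app tot.
have esum_class b :=
  @total_parity_esum R p Lambda theta1 theta2 a b p1 irr a0 app tot.
split; first by left.
- rewrite -[RHS](esum_class false); congr esum; apply/seteqP; split=> l /=.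
    by move=> [[->|Ll] /negbTE lo l0].
  by move=> [Ll lo l0]; split=> //; [right | rewrite lo].
- rewrite -[RHS](esum_class true); congr esum; apply/seteqP; split=> l /=.
    by move=> [[->|Ll] lo] //; split=> //; case: l lo {Ll}.
  by move=> [Ll lo l0]; split=> //; right.
Qed.
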